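(* Let $(X,(\cdot,\cdot|\cdot))$ be a $2$-inner product space over $\mathbb{K}$ ($\mathbb{K}=\mathbb{R}$ or $\mathbb{C}$), let $x,y,z\in X$ and $a,A\in\mathbb{K}$ with $A\ne -a$. If $$\operatorname{Re}\,(Ay-x,\,x-ay\,|\,z)\ge 0,$$ or, equivalently, $$\left\Vert x-\tfrac{a+A}{2}\,y\,\middle|\,z\right\Vert\le \tfrac12|A-a|\,\Vert y|z\Vert ,$$ then $$0\le \Vert x|z\Vert\Vert y|z\Vert-|(x,y|z)|\le \Vert x|z\Vert\Vert y|z\Vert-\operatorname{Re}\left[\operatorname{sgn}\left(\frac{\bar a+\bar A}{2}\right)(x,y|z)\right]\le \frac14\,\frac{|A-a|^2}{|A+a|}\,\Vert y|z\Vert^2,$$ where $\operatorname{sgn}(\alpha):=\alpha/|\alpha|$ for $\alpha\in\mathbb{C}\setminus\{0\}$. The constant $\frac14$ is best possible in the sense that it cannot be replaced by a smaller constant: for every real $D<\frac14$ there exist a $2$-inner product space over $\mathbb{K}$, vectors $x,y,z$ in it and scalars $a,A\in\mathbb{K}$ with $A\neq -a$ satisfying $\operatorname{Re}\,(Ay-x,\,x-ay\,|\,z)\ge 0$ for which $$\Vert x|z\Vert\Vert y|z\Vert-|(x,y|z)|> D\,\frac{|A-a|^2}{|A+a|}\,\Vert y|z\Vert^2 .$$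
   Context: Let $X$ be a linear space of dimension greater than $1$ over $\mathbb{K}$, where $\mathbb{K}=\mathbb{R}$ or $\mathbb{K}=\mathbb{C}$. A $2$-inner product on $X$ is a function $(\cdot,\cdot|\cdot):X\times X\times X\to\mathbb{K}$ such that for all $x,x',y,z\in X$ and $\alpha\in\mathbb{K}$: (1) $(x,x|z)\ge 0$, and $(x,x|z)=0$ if and only if $x$ and $z$ are linearly dependent; (2) $(x,x|z)=(z,z|x)$; (3) $(y,x|z)=\overline{(x,y|z)}$; (4) $(\alpha x,y|z)=\alpha(x,y|z)$; (5) $(x+x',y|z)=(x,y|z)+(x',y|z)$. Then $(X,(\cdot,\cdot|\cdot))$ is called a $2$-inner product space. The associated $2$-norm is $\Vert x|z\Vert=\sqrt{(x,x|z)}$. *)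

(* Defs.v *)
From mathcomp Require Import all_boot all_order all_algebra.
From mathcomp Require Import reals.
From mathcomp Require Import complex.

Set Implicit Arguments.
Unset Strict Implicit.
Unset Printing Implicit Defensive.

Import Order.TTheory GRing.Theory Num.Theory.

Local Open Scope ring_scope.

Inductive scalar_kind := RealScalars | ComplexScalars.

Definition scalar_field (R : realType) (k : scalar_kind) : numFieldType :=
  match k with
  | RealScalars => R
  | ComplexScalars => R[i]%C
  end.

Section Scalars.
Context {R : realType} {k : scalar_kind}.

Definition conjK : scalar_field R k -> scalar_field R k :=
  match k return scalar_field R k -> scalar_field R k with
  | RealScalars => fun a => a
  | ComplexScalars => fun a : R[i]%C => conjc a
  end.

Definition ReK : scalar_field R k -> R :=
  match k return scalar_field R k -> R with
  | RealScalars => fun a => a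
  | ComplexScalars => fun a : R[i]%C => complex.Re a
  end.

(* The library norm takes its values in the scalar field itself; this is the
   same absolute value seen as an element of R. *)
Definition absK (a : scalar_field R k) : R := ReK `|a|.

(* Num.sg is not used here: on non-real complex numbers it is -1. *)
Definition sgnK (a : scalar_field R k) : scalar_field R k := a / `|a|.

End Scalars.

Definition lin_dep2 (K : fieldType) (X : lmodType K) (x z : X) : Prop :=
  exists p q : K, (p, q) <> (0, 0) /\ p *: x + q *: z = 0.

(* X has dimension greater than 1, possibly infinite. *)
Definition dim_gt1 (K : fieldType) (X : lmodType K) : Prop :=
  exists u v : X, ~ lin_dep2 u v.

(* ip x y z stands for (x, y | z).  For complex scalars, 0 <= a in the library
   order means that a is real and nonnegative. *)
Record is_two_inner_product (R : realType) (k : scalar_kind)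
    (X : lmodType (scalar_field R k)) (ip : X -> X -> X -> scalar_field R k) : Prop := {
  tip_ge0 : forall x z, 0 <= ip x x z;
  tip_eq0 : forall x z, ip x x z = 0 <-> lin_dep2 x z;
  tip_swap : forall x z, ip x x z = ip z z x;
  tip_conj : forall x y z, ip y x z = conjK (ip x y z);
  tip_scale : forall a x y z, ip (a *: x) y z = a * ip x y z;
  tip_add : forall x x' y z, ip (x + x') y z = ip x y z + ip x' y z
}.

Record two_inner_space (R : realType) (k : scalar_kind) := TwoInnerSpace {
  tis_carrier :> lmodType (scalar_field R k);
  tip : tis_carrier -> tis_carrier -> tis_carrier -> scalar_field R k;
  tis_dim : dim_gt1 tis_carrier;
  tip_axioms : is_two_inner_product tip
}.

Definition two_norm (R : realType) (k : scalar_kind) (X : two_inner_space R k)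
    (x z : X) : R := Num.sqrt (ReK (tip x x z)).

(* Main.v *)
(* With m = (a + A)/2 and d = (A - a)/2, one has Ay - x = dy - u and
   x - ay = dy + u for u = x - my, so Re (Ay - x, x - ay | z) equals
   |d|^2 ||y|z||^2 - ||x - my|z||^2.  Expanding the last norm and using
   2 |m| ||x|z|| ||y|z|| <= ||x|z||^2 + |m|^2 ||y|z||^2 gives the upper bound.
   Equality holds in K^3 with the Gram 2-inner product for x = e_1, y = e_0,
   z = e_2, m = 1 and d = sqrt 2; dimension 3 is needed because in dimension 2
   ||x|z|| ||y|z|| - |(x, y | z)| always vanishes. *)
Require Import Defs.
From HB Require Import structures.
From mathcomp Require Import all_boot all_order all_algebra.
From mathcomp Require Import reals.
From mathcomp Require Import complex ring lra.

Import Order.TTheory GRing.Theory Num.Theory.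

Local Open Scope ring_scope.

(** * Scalar calculus carried out uniformly over the real and complex fields *)

Definition ofR {R : realType} {k : scalar_kind} : R -> scalar_field R k :=
  match k return R -> scalar_field R k with
  | RealScalars => fun r => r
  | ComplexScalars => fun r => (r%:C)%C
  end.

Section ScalarTheory.
Context {R : realType} {k : scalar_kind}.
Implicit Types (a b : scalar_field R k) (r s : R).

Lemma conjK_is_zmod_morphism : zmod_morphism (@conjK R k).
Proof. by case: k => // a b; rewrite /conjK rmorphB. Qed.

Lemma conjK_is_monoid_morphism : monoid_morphism (@conjK R k).
Proof. by case: k; split=> // [|a b]; [exact: conjc1|exact: rmorphM]. Qed.

HB.instance Definition _ := GRing.isZmodMorphism.Build _ _ (@conjK R k)
  conjK_is_zmod_morphism.
HB.instance Definition _ := GRing.isMonoidMorphism.Build _ _ (@conjK R k)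
  conjK_is_monoid_morphism.

Lemma ReK_is_zmod_morphism : zmod_morphism (@ReK R k).
Proof. by case: k => // -[? ?] [? ?]. Qed.

HB.instance Definition _ := GRing.isZmodMorphism.Build _ _ (@ReK R k)
  ReK_is_zmod_morphism.

Lemma ofR_is_zmod_morphism : zmod_morphism (@ofR R k).
Proof. by case: k => // a b; rewrite /ofR rmorphB. Qed.

Lemma ofR_is_monoid_morphism : monoid_morphism (@ofR R k).
Proof. by case: k; split=> // a b; exact: rmorphM. Qed.

HB.instance Definition _ := GRing.isZmodMorphism.Build _ _ (@ofR R k)
  ofR_is_zmod_morphism.
HB.instance Definition _ := GRing.isMonoidMorphism.Build _ _ (@ofR R k)
  ofR_is_monoid_morphism.

Lemma conjKK a : conjK (conjK a) = a.
Proof. by case: k a => //= a; rewrite conjcK. Qed.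

Lemma ReK_conj a : ReK (conjK a) = ReK a.
Proof. by case: k a => //= -[]. Qed.

Lemma ReK_conjMl a b : ReK (conjK a * b) = ReK (a * conjK b).
Proof. by rewrite -ReK_conj rmorphM /= conjKK. Qed.

Lemma ReK_ofR r : ReK (ofR r : scalar_field R k) = r.
Proof. by case: k. Qed.

Lemma conjK_ofR r : conjK (ofR r) = ofR r :> scalar_field R k.
Proof. by case: k => //=; rewrite oppr0. Qed.

Lemma ReK_ofRM r a : ReK (ofR r * a) = r * ReK a.
Proof. by case: k a => //= -[u v] /=; rewrite mul0r subr0. Qed.

Lemma normr_absK a : `|a| = ofR (absK a).
Proof. by case: k a => //= a; rewrite /absK normc_def. Qed.

Lemma absK_ge0 a : 0 <= absK a.
Proof. by case: k a => [a|a]; rewrite /absK ?normc_def /= ?sqrtr_ge0. Qed.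

Lemma ReK_ge0 a : 0 <= a -> 0 <= ReK a.
Proof. by case: k a => //= a; rewrite lecE => /andP[]. Qed.

Lemma ReK_le_absK a : ReK a <= absK a.
Proof.
case: k a => [a|a]; first exact: ler_norm.
apply: le_trans (ler_norm _) _.
(* The complex order compares real parts and forces equal imaginary parts; the second conjunct is
   the real inequality. *)
by have := normc_ge_Re a; rewrite lecE => /andP[].
Qed.

Lemma absK_ofR r : absK (ofR r : scalar_field R k) = `|r|.
Proof.
case: k => //; rewrite /absK normc_def /= expr0n addr0.
by rewrite sqrtr_sqr.
Qed.

Lemma absKM a b : absK (a * b) = absK a * absK b.
Proof. by rewrite {1}/absK normrM [`|a|]normr_absK ReK_ofRM. Qed.

Lemma absK_conj a : absK (conjK a) = absK a.
Proof. by case: k a => // a; congr ReK; exact: normcJ. Qed.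

Lemma absK_eq0 a : (absK a == 0) = (a == 0).
Proof. by rewrite -[RHS]normr_eq0 normr_absK fmorph_eq0. Qed.

Lemma mul_conjK a : a * conjK a = ofR (absK a ^+ 2).
Proof.
rewrite rmorphXn /= -normr_absK; case: k a => /= a.
  by rewrite -normrX ger0_norm ?sqr_ge0.
by rewrite sqr_normc.
Qed.

Lemma mul_conjK_ge0 a : 0 <= a * conjK a.
Proof. by rewrite mul_conjK rmorphXn /= -normr_absK exprn_ge0. Qed.

Lemma absK_sgnK a : a != 0 -> absK (sgnK a) = 1.
Proof.
move=> a0; rewrite /absK normf_div normr_id divff ?normr_eq0 //.
by rewrite -(rmorph1 ofR) ReK_ofR.
Qed.

Lemma ReK_sgnKM a b : ReK (sgnK a * b) = (absK a)^-1 * ReK (a * b).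
Proof. by rewrite /sgnK normr_absK -fmorphV mulrAC mulrC ReK_ofRM. Qed.

End ScalarTheory.

(** * Sesquilinear expansions and the Cauchy-Schwarz inequality *)

Section TwoInnerTheory.
Context {R : realType} {k : scalar_kind} {X : two_inner_space R k}.
Implicit Types (x y z u v : X) (a c d : scalar_field R k).

Lemma tipD u v y z : tip (u + v) y z = tip u y z + tip v y z.
Proof. exact: (tip_add (tip_axioms X)). Qed.

Lemma tipZ c x y z : tip (c *: x) y z = c * tip x y z.
Proof. exact: (tip_scale (tip_axioms X)). Qed.

Lemma tipC x y z : tip y x z = conjK (tip x y z).
Proof. exact: (tip_conj (tip_axioms X)). Qed.

Lemma tipN x y z : tip (- x) y z = - tip x y z.
Proof. by rewrite -scaleN1r tipZ mulN1r. Qed.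

Lemma tipDr x u v z : tip x (u + v) z = tip x u z + tip x v z.
Proof. by rewrite tipC tipD rmorphD /= -!tipC. Qed.

Lemma tipZr c x y z : tip x (c *: y) z = conjK c * tip x y z.
Proof. by rewrite tipC tipZ rmorphM /= -tipC. Qed.

Lemma tipNr x y z : tip x (- y) z = - tip x y z.
Proof. by rewrite tipC tipN rmorphN /= -tipC. Qed.

Lemma two_norm_ge0 x z : 0 <= two_norm x z.
Proof. exact: sqrtr_ge0. Qed.

Lemma sqr_two_norm x z : two_norm x z ^+ 2 = ReK (tip x x z).
Proof. by rewrite sqr_sqrtr // ReK_ge0 // (tip_ge0 (tip_axioms X)). Qed.

(** The two cross terms are conjugate, so their real parts agree and merge into one doubled term. *)
Lemma sqr_two_normB c x y z :
  two_norm (x - c *: y) z ^+ 2 =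
  two_norm x z ^+ 2 - 2 * ReK (conjK c * tip x y z)
  + absK c ^+ 2 * two_norm y z ^+ 2.
Proof.
rewrite !sqr_two_norm tipD !tipDr !tipN !tipNr !tipZ !tipZr (tipC x y) opprK.
rewrite mulrA mul_conjK !raddfD /= !raddfN /= ReK_ofRM ReK_conjMl; ring.
Qed.

(** The cross terms are conjugate with opposite signs, so they cancel in the real part. This turns
    the hypothesis of the theorem into a comparison of two norms. *)
Lemma ReK_tipB_D c x u z :
  ReK (tip (c *: x - u) (c *: x + u) z) =
  absK c ^+ 2 * two_norm x z ^+ 2 - two_norm u z ^+ 2.
Proof.
rewrite !sqr_two_norm tipD !tipDr !tipN !tipZ !tipZr (tipC u x).
rewrite mulrA mul_conjK !raddfD /= !raddfN /= ReK_ofRM ReK_conjMl; ring.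
Qed.

(* When [two_norm y z = 0] the nonnegative quadratic [H] is affine in [s], so
   its slope must vanish; hence the separate choice of [s] in that case. *)
Lemma two_CauchySchwarz x y z :
  absK (tip x y z) <= two_norm x z * two_norm y z.
Proof.
set t := tip x y z; set p := two_norm x z; set q := two_norm y z.
have pge0 : 0 <= p := two_norm_ge0 x z.
have qge0 : 0 <= q := two_norm_ge0 y z.
(* With the scalar [s * t] and [s] real, the cross term becomes the real number [s |t|^2]. *)
have H s : 0 <= p ^+ 2 - 2 * s * absK t ^+ 2 + s ^+ 2 * absK t ^+ 2 * q ^+ 2.
  have := sqr_ge0 (two_norm (x - (ofR s * t) *: y) z).
  rewrite sqr_two_normB -/t -/p -/q rmorphM /= conjK_ofR -mulrA.
  rewrite (mulrC (conjK t)) mul_conjK -rmorphM ReK_ofR absKM exprMn absK_ofR.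
  by rewrite -normrX ger0_norm ?sqr_ge0 // mulrA.
rewrite -[leLHS](ger0_norm (absK_ge0 t)) -[leRHS]ger0_norm ?mulr_ge0 //.
rewrite -ler_sqr ?nnegrE ?normr_ge0 // !real_normK ?num_real // exprMn.
have [q0|q0] := eqVneq q 0.
  have [-> |t0] := eqVneq (absK t) 0.
    by rewrite expr0n /= mulr_ge0 ?sqr_ge0.
  (* Chosen so that [H s] reads [0 <= -1]. *)
  pose s := (p ^+ 2 + 1) / (2 * absK t ^+ 2).
  have := H s; have -> : 2 * s * absK t ^+ 2 = p ^+ 2 + 1 by rewrite /s; field.
  by rewrite q0 expr0n !mulr0; lra.
have q2 : 0 < q ^+ 2 by rewrite exprn_even_gt0.
(* The quadratic is minimal at [s = q^-2]; the factor [q^2] clears the denominator. *)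
have := mulr_ge0 (ltW q2) (H (q ^- 2)).
rewrite [X in 0 <= X](_ : _ = p ^+ 2 * q ^+ 2 - absK t ^+ 2); last by field.
by rewrite subr_ge0.
Qed.

End TwoInnerTheory.

(* By Lagrange's identity, [gram_ip x y z] is twice
   [<x, y> <z, z> - <x, z> <z, y>] for the standard inner product. *)
Definition gram_ip {R : realType} {k : scalar_kind} {n : nat}
    (x y z : 'rV[scalar_field R k]_n) : scalar_field R k :=
  \sum_i \sum_j (x 0 i * z 0 j - x 0 j * z 0 i)
                * conjK (y 0 i * z 0 j - y 0 j * z 0 i).

(** * The Gram form satisfies the 2-inner product axioms *)

Section GramProduct.
Context {R : realType} {k : scalar_kind} {n : nat}.
Implicit Types x y z : 'rV[scalar_field R k]_n.

(** The form at [x, x, z] is the sum of the squared moduli of all 2 by 2 minors of the pair, so it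
    vanishes exactly when every minor does. *)
Lemma gram_ip_eq0 x z : gram_ip x x z = 0 <-> lin_dep2 x z.
Proof.
split=> [/eqP|[p [q [pq0 pxqz]]]].
  rewrite psumr_eq0 => [/allP H|i _]; last first.
    by apply: sumr_ge0 => j _; exact: mul_conjK_ge0.
  have minor0 i j : x 0 i * z 0 j = x 0 j * z 0 i.
    have := H i (mem_index_enum i); rewrite /= psumr_eq0; last first.
      by move=> l _; exact: mul_conjK_ge0.
    move=> /allP /(_ j (mem_index_enum j)) /=.
    by rewrite mul_conjK fmorph_eq0 sqrf_eq0 absK_eq0 subr_eq0 => /eqP.
  have [->|/rV0Pn[j zj0]] := eqVneq z 0.
    exists 0, 1; split; last by rewrite scale0r scaler0 addr0.
    by case=> /eqP; rewrite oner_eq0.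
  (* The vanishing minors involving the fixed index [j] say that [z_j x - x_j z = 0], and [z_j] is
     nonzero. *)
  exists (z 0 j), (- x 0 j); split; first by case=> zj; rewrite zj eqxx in zj0.
  by apply/rowP=> i; rewrite !mxE mulrC minor0 mulNr subrr.
have pxqzE i : p * x 0 i + q * z 0 i = 0.
  by have /rowP/(_ i) := pxqz; rewrite !mxE.
apply: big1 => i _; apply: big1 => j _.
suff -> : x 0 i * z 0 j - x 0 j * z 0 i = 0 by rewrite mul0r.
have [p0|p0] := eqVneq p 0.
  have q0 : q != 0 by apply/eqP => q0; case: pq0; rewrite p0 q0.
  have z0 l : z 0 l = 0.
    apply/eqP; have /eqP := pxqzE l.
    by rewrite p0 mul0r add0r mulf_eq0 (negPf q0).
  by rewrite !z0 !mulr0 subrr.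
(* [p] times the minor is a combination of two coordinates of [p x + q z], since the [q] terms
   cancel. *)
apply: (mulfI p0); rewrite mulr0.
transitivity ((p * x 0 i + q * z 0 i) * z 0 j
              - (p * x 0 j + q * z 0 j) * z 0 i); first by ring.
by rewrite !pxqzE !mul0r subrr.
Qed.

Lemma gram_ip_two_inner : is_two_inner_product (@gram_ip R k n).
Proof.
split.
- move=> x z; apply: sumr_ge0 => i _; apply: sumr_ge0 => j _.
  exact: mul_conjK_ge0.
- exact: gram_ip_eq0.
- move=> x z; apply: eq_bigr => i _; apply: eq_bigr => j _.
  (* Exchanging [x] and [z] changes the sign of both minors, which leaves their product
     unchanged. *)
  rewrite -mulrNN -rmorphN /= !opprB.
  by rewrite (mulrC (z 0 i)) (mulrC (z 0 j)).
- move=> x y z; rewrite /gram_ip rmorph_sum /=; apply: eq_bigr => i _.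
  rewrite rmorph_sum /=; apply: eq_bigr => j _.
  by rewrite rmorphM /= conjKK mulrC.
- move=> a x y z; rewrite mulr_sumr; apply: eq_bigr => i _.
  by rewrite mulr_sumr; apply: eq_bigr => j _; rewrite !mxE; ring.
- move=> x x' y z; rewrite -big_split; apply: eq_bigr => i _.
  by rewrite -big_split; apply: eq_bigr => j _; rewrite !mxE /=; ring.
Qed.

End GramProduct.

Section GramSpace.
Context {R : realType} {k : scalar_kind}.

Local Notation e i := (delta_mx 0 i : 'rV[scalar_field R k]_3).

(** The minors of [e i] and [e 2] vanish except at positions [(i, 2)] and [(2, i)], where they are 1
    and -1; these two positions give the factor 2. *)
Lemma gram_ip_delta (i j : 'I_3) : i != 2 -> j != 2 ->
  gram_ip (e i) (e j) (e 2) = (2 * (i == j))%:R.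
Proof.
case: i j => [[|[|[]]] // Hi] [[|[|[]]] // Hj] _ _;
by rewrite /gram_ip !big_ord_recl !big_ord0 !mxE /=
  !(mulr0, mul0r, mulr1, subr0, sub0r, addr0, add0r, mulr0n,
    rmorph0, rmorph1, rmorphN, mulrNN).
Qed.

Lemma gram_space_dim : dim_gt1 'rV[scalar_field R k]_3.
Proof.
exists (e 0), (e 2) => /gram_ip_eq0/eqP.
by rewrite gram_ip_delta // pnatr_eq0.
Qed.

End GramSpace.

Definition gram_space (R : realType) (k : scalar_kind) : two_inner_space R k :=
  TwoInnerSpace gram_space_dim gram_ip_two_inner.

Theorem theorem3 (R : realType) (k : scalar_kind) :
  (forall (X : two_inner_space R k) (x y z : X) (a A : scalar_field R k),
     A != - a ->
     (0 <= ReK (tip (A *: y - x) (x - a *: y) z) <->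
      two_norm (x - ((a + A) / 2) *: y) z
        <= 1 / 2 * absK (A - a) * two_norm y z)
     /\
     (0 <= ReK (tip (A *: y - x) (x - a *: y) z) ->
      [/\ 0 <= two_norm x z * two_norm y z - absK (tip x y z),
          two_norm x z * two_norm y z - absK (tip x y z)
            <= two_norm x z * two_norm y z
               - ReK (sgnK ((conjK a + conjK A) / 2) * tip x y z)
        & two_norm x z * two_norm y z
               - ReK (sgnK ((conjK a + conjK A) / 2) * tip x y z)
            <= 1 / 4 * (absK (A - a) ^+ 2 / absK (A + a))
               * two_norm y z ^+ 2]))
  /\
  (forall D : R, D < 1 / 4 ->
     exists (X : two_inner_space R k) (x y z : X) (a A : scalar_field R k),
       [/\ A != - a,
           0 <= ReK (tip (A *: y - x) (x - a *: y) z)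
         & D * (absK (A - a) ^+ 2 / absK (A + a)) * two_norm y z ^+ 2
             < two_norm x z * two_norm y z - absK (tip x y z)]).
Proof.
split=> [X x y z a A Aa|D D4].
  set m := (a + A) / 2; set d := (A - a) / 2.
  have two0 : 2 != 0 :> scalar_field R k by rewrite pnatr_eq0.
  have mdA : m + d = A by rewrite /m /d; field.
  have dma : d - m = - a by rewrite /m /d; field.
  have m0 : m != 0.
    by rewrite mulf_neq0 ?invr_eq0 // addrC -(opprK a) subr_eq0.
  have conjm : (conjK a + conjK A) / 2 = conjK m.
    by rewrite -rmorphD /= /m rmorphM /= fmorphV rmorph_nat.
  have half c : absK (c / 2 : scalar_field R k) = absK c / 2.
    have -> : 2^-1 = ofR 2^-1 :> scalar_field R k by rewrite fmorphV rmorph_nat.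
    by rewrite absKM absK_ofR ger0_norm ?invr_ge0.
  have absd : absK (A - a) = 2 * absK d by rewrite half; field.
  have absm : absK (A + a) = 2 * absK m by rewrite half addrC; field.
  have ReE : ReK (tip (A *: y - x) (x - a *: y) z) =
             absK d ^+ 2 * two_norm y z ^+ 2 - two_norm (x - m *: y) z ^+ 2.
    rewrite -ReK_tipB_D; congr (ReK (tip _ _ z)).
      by rewrite opprB addrA -scalerDl [d + m]addrC mdA.
    by rewrite addrCA -scalerBl dma scaleNr.
  have mgt0 : 0 < absK m by rewrite lt0r absK_eq0 m0 absK_ge0.
  rewrite ReE subr_ge0 absd absm; split.
    (* Both sides are nonnegative, so comparing squares is comparing norms. *)
    rewrite -exprMn ler_sqr ?nnegrE ?mulr_ge0 ?absK_ge0 ?two_norm_ge0 //.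
    by rewrite (_ : 1 / 2 * (2 * absK d) = absK d) //; field.
  move=> ball; rewrite conjm; split.
  - by rewrite subr_ge0 two_CauchySchwarz.
  - rewrite lerD2l lerN2 (le_trans (ReK_le_absK _)) //.
    rewrite absKM absK_sgnK ?mul1r //.
    by rewrite fmorph_eq0.
  - rewrite ReK_sgnKM absK_conj; move: ball; rewrite sqr_two_normB.
    set p := two_norm x z; set q := two_norm y z; set r := ReK _ => ball.
    (* Multiplying by [|m| > 0] clears the denominators left by [sgnK] and by [|A + a|]. *)
    rewrite -(ler_pM2l mgt0).
    have -> : absK m * (p * q - (absK m)^-1 * r) = absK m * p * q - r.
      by field; rewrite gt_eqF.
    have -> : absK m * (1 / 4 * ((2 * absK d) ^+ 2 / (2 * absK m)) * q ^+ 2)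
              = absK d ^+ 2 * q ^+ 2 / 2.
      by field; rewrite gt_eqF.
    (* AM-GM: [2 |m| p q <= p^2 + |m|^2 q^2]. *)
    have := sqr_ge0 (p - absK m * q); rewrite sqrrB exprMn; lra.
(* [s] serves twice: as the half-difference [d], and as the common norm of [x] and [y], whose square
   2 comes from the factor in [gram_ip]. *)
pose s : R := Num.sqrt 2.
have s2 : s ^+ 2 = 2 by rewrite sqr_sqrtr.
pose x : gram_space R k := delta_mx 0 1.
pose y : gram_space R k := delta_mx 0 0.
pose z : gram_space R k := delta_mx 0 2.
have tipxx : tip x x z = ofR 2 by rewrite rmorph_nat [LHS]gram_ip_delta.
have tipyy : tip y y z = ofR 2 by rewrite rmorph_nat [LHS]gram_ip_delta.
have tipxy : tip x y z = 0 by rewrite [LHS]gram_ip_delta.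
have normx : two_norm x z = s by rewrite /two_norm tipxx ReK_ofR.
have normy : two_norm y z = s by rewrite /two_norm tipyy ReK_ofR.
(* These are [m - d] and [m + d] with [m = 1]: equal norms make AM-GM an equality. *)
exists (gram_space R k), x, y, z, (ofR (1 - s)), (ofR (1 + s)).
have subE : ofR (1 + s) - ofR (1 - s) = ofR (2 * s) :> scalar_field R k.
  by rewrite -rmorphB; congr ofR; ring.
have addE : ofR (1 + s) + ofR (1 - s) = ofR 2 :> scalar_field R k.
  by rewrite -rmorphD; congr ofR; ring.
split.
- by rewrite -addr_eq0 addE rmorph_nat pnatr_eq0.
- rewrite tipD !tipDr !tipN !tipNr !tipZ !tipZr (tipC x y) tipxx tipyy tipxy.
  rewrite rmorph0 !mulr0 sub0r opprK addr0 conjK_ofR.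
  rewrite -!rmorphM -!rmorphN -rmorphD ReK_ofR.
  (* The real part is exactly 0: [-2 (1 + s) (1 - s) - 2 = 2 s^2 - 4]. *)
  by nra.
- rewrite subE addE tipxy normx normy !absK_ofR.
  rewrite -[0](rmorph0 ofR) absK_ofR normr0.
  (* With [s^2 = 2] the claim reduces to [8 D < 2]. *)
  rewrite real_normK ?num_real // normr_nat exprMn -expr2 s2; lra.
Qed.
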